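(* 1. Every I$_{\vdots}$-point and every II$_{\vdots}$-point of $\mathrm{PG}(8,q)$ is contained in a unique hwise-fixed-5-space. 2. Every fixed-I-line and every fixed-II-line is contained in a unique hwise-fixed-5-space.
   Context: Let $q>2$ be a prime power. Let $\phi$ be a collineation of $\mathrm{PG}(2,q^3)$ of order 3 fixing pointwise an $\mathbb F_q$-subplane $\mathcal P_{2,q}$. A point $\bar P$ of $\mathrm{PG}(2,q^3)$ has Type I if in $\mathcal P_{2,q}$, Type II if $\bar P,\bar P^\phi,\bar P^{\phi^2}$ are distinct and collinear, Type III otherwise. Bose representation: identifying $\mathbb F_{q^3}^3$ with $\mathbb F_q^9$, each point $\bar P$ corresponds to a plane $[\![P]\!]$ of $\mathrm{PG}(8,q)$; a point of $\mathrm{PG}(8,q)$ is an X-point if it lies in $[\![P]\!]$ with $\bar P$ of Type X. $\phi$ induces a projectivity $\sigma$ of $\mathrm{PG}(8,q)$ of order 3 with $[\![P]\!]^\sigma=[\![P^\phi]\!]$. A I-point $A$ is a I$_{\vdots}$-point if $A,A^\sigma,A^{\sigma^2}$ are distinct and collinear; a II-point $B$ is a II$_{\vdots}$-point if $B,B^\sigma,B^{\sigma^2}$ are collinear. A fixed-I-line (fixed-II-line) is a $\sigma$-fixed line containing a I$_{\vdots}$-point (II$_{\vdots}$-point). A hwise-fixed-5-space is a 5-space $\Pi$ such that every 6-space containing $\Pi$ is fixed by $\sigma$. *)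

(* Defs.v *)
From HB Require Import structures.
From mathcomp Require Import all_boot all_order all_algebra all_field.

Set Implicit Arguments.
Unset Strict Implicit.
Unset Printing Implicit Defensive.

Import GRing.Theory.
Local Open Scope ring_scope.

(* PG K n d is the type of the d-dimensional (projective dimension) subspaces
   of the projective space PG(n, K). *)
Definition PG (K : fieldType) (n d : nat) : Type :=
  {U : {vspace 'rV[K]_n.+1} | \dim U == d.+1}.

Notation PGpoint K n := (PG K n 0).
Notation PGline K n := (PG K n 1).

Definition vs (K : fieldType) (n d : nat) (U : PG K n d) :
  {vspace 'rV[K]_n.+1} := sval U.

Definition incident (K : fieldType) (n d e : nat) (U : PG K n d)
  (W : PG K n e) : Prop := (vs U <= vs W)%VS.

Definition collinear (K : fieldType) (n : nat) (P Q R : PGpoint K n) : Prop :=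
  exists l : PGline K n, [/\ incident P l, incident Q l & incident R l].

Definition distinct3 (T : Type) (x y z : T) : Prop :=
  [/\ x <> y, x <> z & y <> z].

Definition has_order (T : Type) (f : T -> T) (n : nat) : Prop :=
  [/\ (0 < n)%N, iter n f =1 id
    & forall k, (0 < k < n)%N -> ~ iter k f =1 id].

Definition collineation (K : fieldType) (n : nat)
    (phi : PGpoint K n -> PGpoint K n) : Prop :=
  bijective phi /\
  forall P Q R, collinear P Q R <-> collinear (phi P) (phi Q) (phi R).

Definition projectivity (K : fieldType) (n : nat)
    (sigma : PGpoint K n -> PGpoint K n) : Prop :=
  exists2 g : 'End('rV[K]_n.+1), lker g = 0%VS &
    forall A, vs (sigma A) = (g @: vs A)%VS.

(* W is the image U^sigma of U, as sets of points. *)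
Definition maps_onto (K : fieldType) (n : nat)
    (sigma : PGpoint K n -> PGpoint K n) (U W : {vspace 'rV[K]_n.+1}) : Prop :=
  forall B : PGpoint K n, (vs B <= W)%VS <->
    exists2 A : PGpoint K n, (vs A <= U)%VS & sigma A = B.

Definition fixes (K : fieldType) (n d : nat)
    (sigma : PGpoint K n -> PGpoint K n) (U : PG K n d) : Prop :=
  maps_onto sigma (vs U) (vs U).

(* The rows of M are a basis of L^3; the subplane consists of the points having
   homogeneous coordinates in F with respect to that basis. *)
Definition Fsubplane (F : fieldType) (L : fieldExtType F)
    (S : PGpoint L 2 -> Prop) : Prop :=
  exists2 M : 'M[L]_3, M \in unitmx &
    forall P, S P <->
      exists2 a : 'rV[F]_3, a != 0 & vs P = <[map_mx (in_alg L) a *m M]>%VS.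

Definition typeII (L : fieldType) (phi : PGpoint L 2 -> PGpoint L 2)
    (P : PGpoint L 2) : Prop :=
  distinct3 P (phi P) (phi (phi P)) /\ collinear P (phi P) (phi (phi P)).

(* An identification of L^3 with F^9 is any F-linear bijection, where F acts on
   L^3 through the embedding a |-> a%:A of F in L. *)
Definition identification (F : fieldType) (L : fieldExtType F)
    (beta : 'rV[L]_3 -> 'rV[F]_9) : Prop :=
  bijective beta /\
  forall (a : F) (u v : 'rV[L]_3), beta (a%:A *: u + v) = a *: beta u + beta v.

(* The plane [[P]] of PG(8, F): the beta-image of P viewed as an F-space.
   See mem_bose and dim_bose. *)
Definition bose (F : fieldType) (L : fieldExtType F)
    (beta : 'rV[L]_3 -> 'rV[F]_9) (P : PGpoint L 2) : {vspace 'rV[F]_9} :=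
  limg (linfun (fun l : L => beta (l *: vpick (vs P)))).

Section BoseFacts.
Variables (F : fieldType) (L : fieldExtType F) (beta : 'rV[L]_3 -> 'rV[F]_9).
Hypothesis beta_id : identification beta.
Variable P : PGpoint L 2.

Let f (l : L) := beta (l *: vpick (vs P)).

Fact bose_linear : linear f.
Proof.
by move=> a u v; rewrite /f scalerDl -beta_id.2 scalerA -scalerAl mul1r.
Qed.

Fact bose_linfunE (l : L) : linfun f l = f l.
Proof.
pose fL := GRing.isLinear.Build F L 'rV[F]_9 *:%R f bose_linear.
pose g : {linear L -> 'rV[F]_9} := HB.pack f fL.
exact: (lfunE g).
Qed.

Lemma vpick_PGpoint : vpick (vs P) != 0 /\ vs P = <[vpick (vs P)]>%VS.
Proof.
have dP : \dim (vs P) = 1%N by apply/eqP; apply: (svalP P).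
have nz : vpick (vs P) != 0 by rewrite vpick0 -dimv_eq0 dP.
split=> //; apply/esym/eqP; rewrite eqEdim dP dim_vline nz andbT.
by rewrite -memvE memv_pick.
Qed.

Lemma mem_bose (v : 'rV[L]_3) : (beta v \in bose beta P) = (v \in vs P).
Proof.
have [nz eP] := vpick_PGpoint.
apply/memv_imgP/idP => [[l _]|].
  rewrite bose_linfunE /f => /(bij_inj beta_id.1) ->.
  by rewrite memvZ ?memv_pick.
rewrite [in X in X -> _]eP => /vlineP[l ->].
by exists l; rewrite ?memvf // bose_linfunE.
Qed.

Lemma dim_bose : \dim (bose beta P) = \dim {:L}.
Proof.
have [nz _] := vpick_PGpoint.
apply: limg_dim_eq; apply/eqP; rewrite -subv0; apply/subvP => l.
rewrite memv_cap => /andP[_]; rewrite memv_ker bose_linfunE memv0 /f.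
have b0 : beta 0 = 0.
  have := beta_id.2 1 0 0; rewrite scaler0 addr0 scale1r => /eqP.
  by rewrite -subr_eq0 opprD addNKr oppr_eq0 => /eqP.
rewrite -{1}b0 => /eqP/(bij_inj beta_id.1)/eqP.
by rewrite scaler_eq0 (negPf nz) orbF.
Qed.
End BoseFacts.

Section BosePoints.
Variables (F : fieldType) (L : fieldExtType F).
Variables (beta : 'rV[L]_3 -> 'rV[F]_9) (S : PGpoint L 2 -> Prop).
Variables (phi : PGpoint L 2 -> PGpoint L 2) (sigma : PGpoint F 8 -> PGpoint F 8).

Definition I_point (A : PGpoint F 8) : Prop :=
  exists2 P, S P & (vs A <= bose beta P)%VS.

Definition II_point (A : PGpoint F 8) : Prop :=
  exists2 P, typeII phi P & (vs A <= bose beta P)%VS.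

Definition Idots_point (A : PGpoint F 8) : Prop :=
  [/\ I_point A, distinct3 A (sigma A) (sigma (sigma A))
    & collinear A (sigma A) (sigma (sigma A))].

Definition IIdots_point (B : PGpoint F 8) : Prop :=
  II_point B /\ collinear B (sigma B) (sigma (sigma B)).

Definition fixed_I_line (l : PGline F 8) : Prop :=
  fixes sigma l /\ exists2 A, Idots_point A & incident A l.

Definition fixed_II_line (l : PGline F 8) : Prop :=
  fixes sigma l /\ exists2 B, IIdots_point B & incident B l.

Definition hwise_fixed_5space (Pi : PG F 8 5) : Prop :=
  forall H : PG F 8 6, incident Pi H -> fixes sigma H.
End BosePoints.

(* Main.v *)
Require Import Defs.
From HB Require Import structures.
From mathcomp Require Import all_boot all_order all_algebra all_field.
From mathcomp Require Import ring.

Set Implicit Arguments.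
Unset Strict Implicit.
Unset Printing Implicit Defensive.

Import GRing.Theory.
Local Open Scope ring_scope.

(* The projectivity sigma is induced by g in GL(9, F) with g^3 = c. In
   coordinates with respect to the subplane, L^3 = L (x) F^3 and g = h (x) 1,
   where h is semilinear for an automorphism m of L of order 3 with fixed
   field F. A 5-space is hwise-fixed iff it is the image of g - e with
   e^3 = c, since g must act as a homothety on the quotient; by independence
   of 1, m, m^2 this image has vector dimension 6 and equals the kernel of
   g^2 + e g + e^2. If <v>, <g v>, <g^2 v> are distinct and collinear, the
   minimal polynomial of v is a quadratic divisor of X^3 - c, hence equals
   X^2 + e X + e^2 for exactly one e. *)

(** * Linear maps that are proportional at every vector *)

Definition lfun_evalE := (add_lfunE, opp_lfunE, scale_lfunE, comp_lfunE, id_lfunE).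

(** If [q x] and [q y] are independent, comparing [f (x + y)] with [q (x + y)] forces the factors at
    [x] and [y] to agree. Every [w] with [q w != 0] can be compared in this way with [w1] or [w2],
    because [q w] cannot lie on both of the independent lines that they span. *)
Lemma pointwise_multiple (K : fieldType) (U W : vectType K) (f q : 'Hom(U, W))
    (w1 w2 : U) :
  (forall w, f w \in <[q w]>%VS) -> q w1 != 0 -> q w2 \notin <[q w1]>%VS ->
  exists e : K, f = e *: q.
Proof.
move=> fq q1 q2.
have indep x y : q x != 0 -> q y \notin <[q x]>%VS -> forall a b,
    a *: q x + b *: q y = 0 -> a = 0 /\ b = 0.
  move=> qx qy a b.
  have [->|b0] := eqVneq b 0.
    by rewrite scale0r addr0 => /eqP; rewrite scaler_eq0 (negPf qx) orbF => /eqP.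
  move=> /eqP; rewrite addr_eq0 => /eqP E; case/negP: qy.
  apply/vlineP; exists (- (b^-1 * a)).
  by rewrite scaleNr -scalerA E scalerN opprK scalerK.
have pair x y a : q x != 0 -> q y \notin <[q x]>%VS ->
    f x = a *: q x -> f y = a *: q y.
  move=> qx qy fx; have /vlineP[b fy] := fq y.
  have /vlineP[d] := fq (x + y); rewrite !linearD /= fx fy => E.
  have [] := indep x y qx qy (a - d) (b - d).
    by rewrite !scalerBl addrACA E -opprD -scalerDr subrr.
  by move=> /subr0_eq -> /subr0_eq ->.
have q20 : q w2 != 0 by apply: contraNneq q2 => ->; rewrite mem0v.
have q1' : q w1 \notin <[q w2]>%VS.
  apply: contra q2 => /vlineP[k E]; apply/vlineP; exists k^-1.
  by rewrite E scalerK //; apply: contraNneq q1; rewrite E => ->; rewrite scale0r.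
have /vlineP[e f1] := fq w1; exists e.
have f2 := pair _ _ _ q1 q2 f1.
apply/lfunP=> w; rewrite scale_lfunE.
have [h1|h1] := boolP (q w \in <[q w1]>%VS); last exact: pair h1 f1.
have [h2|h2] := boolP (q w \in <[q w2]>%VS); last exact: pair h2 f2.
have qw : q w = 0.
  move/vlineP: h1 => [a E1]; move/vlineP: h2 => [b E2].
  have [|a0 _] := indep _ _ q1 q2 a (- b); first by rewrite -E1 E2 scaleNr subrr.
  by rewrite E1 a0 scale0r.
by have /vlineP[d ->] := fq w; rewrite qw !scaler0.
Qed.

Lemma mem_lker_add_line (K : fieldType) (V : vectType K) (q : 'End(V)) (w x : V) :
  (x \in lker q + <[w]>)%VS -> q x \in <[q w]>%VS.
Proof.
case/memv_addP=> u uq [_ /vlineP[a ->] ->]; rewrite linearD linearZ /=.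
by move: uq; rewrite memv_ker => /eqP ->; rewrite add0r memvZ // memv_line.
Qed.

(** * Subspaces and the linear map inducing [sigma] *)

Lemma PG_exists (K : fieldType) (n d : nat) (U : {vspace 'rV[K]_n.+1}) :
  \dim U = d.+1 -> exists P : PG K n d, vs P = U.
Proof. by move/eqP=> dU; exists (exist _ U dU). Qed.

Lemma vs_inj (K : fieldType) (n d : nat) : injective (@vs K n d).
Proof. by move=> P Q; apply: val_inj. Qed.

Lemma dim_vs (K : fieldType) (n d : nat) (P : PG K n d) : \dim (vs P) = d.+1.
Proof. by apply/eqP; apply: (svalP P). Qed.

Lemma point_of_vector (K : fieldType) (n : nat) (v : 'rV[K]_n.+1) :
  v != 0 -> exists P : PGpoint K n, vs P = <[v]>%VS.
Proof. by move=> v0; apply: PG_exists; rewrite dim_vline v0. Qed.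

Lemma vector_of_point (K : fieldType) (n : nat) (P : PGpoint K n) :
  exists2 v, v != 0 & vs P = <[v]>%VS.
Proof.
have v0 : vpick (vs P) != 0 by rewrite vpick0 -dimv_eq0 dim_vs.
exists (vpick (vs P)) => //; apply/esym/eqP.
by rewrite eqEdim dim_vs dim_vline v0 -memvE memv_pick.
Qed.

Lemma maps_ontoP (K : fieldType) (n : nat) (sigma : PGpoint K n -> PGpoint K n)
    (g : 'End('rV[K]_n.+1)) (U W : {vspace 'rV[K]_n.+1}) :
  (forall A, vs (sigma A) = (g @: vs A)%VS) ->
  maps_onto sigma U W <-> (g @: U)%VS = W.
Proof.
move=> sg; split=> [m|<- B]; last first.
  split=> [BU|[A AU <-]]; last by rewrite sg limgS.
  have [b b0 Bb] := vector_of_point B.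
  have /memv_imgP[a aU ba] : b \in (g @: U)%VS by rewrite memvE -Bb.
  have [|A Aa] := @point_of_vector K n a.
    by apply: contraNneq b0; rewrite ba => ->; rewrite linear0.
  exists A; first by rewrite Aa -memvE.
  by apply: vs_inj; rewrite sg Aa limg_line -ba.
apply/eqP; rewrite eqEsubv; apply/andP; split; apply/subvP=> x.
  case/memv_imgP=> a aU ->{x}.
  have [->|a0] := eqVneq a 0; first by rewrite linear0 mem0v.
  have [A Aa] := point_of_vector a0.
  have : (vs (sigma A) <= W)%VS by apply/m; exists A; rewrite // Aa -memvE.
  by rewrite sg Aa limg_line -memvE.
move=> xW; have [->|x0] := eqVneq x 0; first by rewrite mem0v.
have [B Bx] := point_of_vector x0.
have /m[A AU AB] : (vs B <= W)%VS by rewrite Bx -memvE.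
by rewrite memvE -Bx -AB sg limgS.
Qed.

(** An injective [g] preserves dimension, so inclusion already gives equality. *)
Lemma sub_fixesP (K : fieldType) (n d : nat) (sigma : PGpoint K n -> PGpoint K n)
    (g : 'End('rV[K]_n.+1)) (H : PG K n d) :
  lker g = 0%VS -> (forall A, vs (sigma A) = (g @: vs A)%VS) ->
  fixes sigma H <-> (g @: vs H <= vs H)%VS.
Proof.
move=> g0 sg; rewrite /fixes; split=> [/(maps_ontoP _ _ sg) ->|gH]; first exact: subvv.
apply/(maps_ontoP _ _ sg)/eqP; rewrite eqEdim gH /=.
by rewrite limg_dim_eq ?g0 ?capv0.
Qed.

(** Order 3 makes every nonzero vector an eigenvector of [g^3], so [g^3] is a homothety by
    [pointwise_multiple] with [q] the identity. The dimension [n.+2] supplies two independent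
    vectors. *)
Lemma cube_scalar (K : fieldType) (n : nat) (sigma : PGpoint K n.+1 -> PGpoint K n.+1)
    (g : 'End('rV[K]_n.+2)) :
  (forall A, vs (sigma A) = (g @: vs A)%VS) -> has_order sigma 3 ->
  exists c : K, forall v, g (g (g v)) = c *: v.
Proof.
move=> sg [_ s3 _].
have [e E] : exists e : K, (g \o g \o g)%VF = e *: \1%VF.
  apply: (@pointwise_multiple _ _ _ _ _ (delta_mx 0 0) (delta_mx 0 1)).
  - move=> w; rewrite !lfun_evalE.
    have [->|w0] := eqVneq w 0; first by rewrite !linear0 mem0v.
    have [A Aw] := point_of_vector w0.
    have := s3 A; rewrite /= => /(congr1 (@vs _ _ _)).
    by rewrite !sg Aw !limg_line memvE => ->.
  - rewrite id_lfunE; apply/eqP => /rowP/(_ 0)/eqP.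
    by rewrite !mxE /= oner_eq0.
  - rewrite !id_lfunE; apply/negP => /vlineP[k] /rowP/(_ 1)/eqP.
    by rewrite !mxE /= mulr0 oner_eq0.
by exists e => v; have /lfunP/(_ v) := E; rewrite !lfun_evalE.
Qed.

(** * The factorization of [X^3 - c] and hwise-fixed 5-spaces *)

(** When [e ^+ 3 = c], the polynomial [X^3 - c] splits as [(X - e)(X^2 + e X + e^2)]; [hwise_factor]
    and [hwise_cofactor] are the values of these two factors at [g]. *)
Definition hwise_factor (K : fieldType) (V : vectType K) (g : 'End(V)) (e : K) : 'End(V) :=
  g - e *: \1%VF.

Definition hwise_cofactor (K : fieldType) (V : vectType K) (g : 'End(V)) (e : K) : 'End(V) :=
  (g \o g)%VF + e *: g + e ^+ 2 *: \1%VF.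

Lemma hwise_factorE (K : fieldType) (V : vectType K) (g : 'End(V)) (e : K) v :
  hwise_factor g e v = g v - e *: v.
Proof. by rewrite !lfun_evalE. Qed.

Lemma hwise_cofactorE (K : fieldType) (V : vectType K) (g : 'End(V)) (e : K) v :
  hwise_cofactor g e v = g (g v) + e *: g v + e ^+ 2 *: v.
Proof. by rewrite !lfun_evalE. Qed.

(** The product of the two factors at [g] is [g^3 - e^3 = 0]. *)
Lemma limg_factor_sub (K : fieldType) (V : vectType K) (g : 'End(V)) (c e : K) :
  (forall v, g (g (g v)) = c *: v) -> e ^+ 3 = c ->
  (limg (hwise_factor g e) <= lker (hwise_cofactor g e))%VS.
Proof.
move=> g3 ec; apply/subvP=> _ /memv_imgP[w _ ->].
rewrite memv_ker hwise_cofactorE hwise_factorE !linearB !linearZ /= g3 -ec.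
rewrite !scalerA -exprSr -expr2.
by rewrite !scalerN !addrA !subrK subrr.
Qed.

(** In [g w = (g w - e w) + e w] the first summand lies in [Pi], and the second stays in any
    subspace containing [w]. *)
Lemma hwise_fixed_factor (K : fieldType) (sigma : PGpoint K 8 -> PGpoint K 8)
    (g : 'End('rV[K]_9)) (e : K) (Pi : PG K 8 5) :
  lker g = 0%VS -> (forall A, vs (sigma A) = (g @: vs A)%VS) ->
  vs Pi = limg (hwise_factor g e) -> hwise_fixed_5space sigma Pi.
Proof.
move=> g0 sg PiE H PiH; apply/(sub_fixesP _ g0 sg)/subvP=> _ /memv_imgP[w wH ->].
rewrite -[g w](subrK (e *: w)) memvD ?memvZ // -hwise_factorE.
by apply: (subvP PiH); rewrite PiE memv_img ?memvf.
Qed.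

Lemma factor_of_hwise_fixed (K : fieldType) (sigma : PGpoint K 8 -> PGpoint K 8)
    (g : 'End('rV[K]_9)) (c : K) (Pi : PG K 8 5) :
  lker g = 0%VS -> (forall A, vs (sigma A) = (g @: vs A)%VS) ->
  (forall v, g (g (g v)) = c *: v) -> hwise_fixed_5space sigma Pi ->
  exists2 e, e ^+ 3 = c & (limg (hwise_factor g e) <= vs Pi)%VS.
Proof.
move=> g0 sg g3 hPi.
(* [q] plays the role of the quotient map by [Pi], modulo which [g] has to
   act as a homothety. *)
pose q := daddv_pi (vs Pi)^C (vs Pi).
have qK : lker q = vs Pi.
  have sumq w : daddv_pi (vs Pi) (vs Pi)^C w + q w = w.
    by rewrite daddv_pi_add ?capv_compl // addv_complf memvf.
  apply/eqP; rewrite eqEsubv; apply/andP; split; apply/subvP=> w.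
    by rewrite memv_ker -{2}[w]sumq => /eqP ->; rewrite addr0 memv_pi.
  move=> wPi; have := sumq w; rewrite daddv_pi_id ?capv_compl // memv_ker.
  by rewrite -[RHS]addr0 => /addrI ->.
have dq : \dim (limg q) = 3%N.
  have := limg_ker_dim q fullv; rewrite capfv qK dim_vs dimvf /dim /= mul1n.
  by move/(congr1 (subn^~ 6)); rewrite addKn.
(* The span of [Pi] and [w] is a 6-space through [Pi], so [g] preserves it; [q] collapses it to
   [<[q w]>]. *)
have inv w x : q w != 0 -> x \in (vs Pi + <[w]>)%VS -> q (g x) \in <[q w]>%VS.
  move=> qw xH; apply: mem_lker_add_line; rewrite qK.
  have dH : \dim (vs Pi + <[w]>) = 7%N.
    rewrite dimv_disjoint_sum ?dim_vs ?dim_vline.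
      by rewrite (contraNneq _ qw) // => ->; rewrite linear0.
    apply/eqP; rewrite -subv0; apply/subvP=> y; rewrite memv_cap memv0.
    case/andP=> yP /vlineP[k yk]; move: yP; rewrite yk -qK memv_ker linearZ /=.
    by rewrite scaler_eq0 (negPf qw) orbF => /eqP ->; rewrite scale0r.
  have [H HE] := PG_exists dH.
  have /(sub_fixesP _ g0 sg)/subvP : fixes sigma H.
    by apply: hPi; rewrite /incident HE addvSl.
  by rewrite -HE; apply; rewrite memv_img // HE.
have [w1 q1] : exists w1, q w1 != 0.
  have : vpick (limg q) != 0 by rewrite vpick0 -dimv_eq0 dq.
  by have /memv_imgP[w _ ->] := memv_pick (limg q); exists w.
have [w2 q2] : exists w2, q w2 \notin <[q w1]>%VS.
  have : ~~ (limg q <= <[q w1]>)%VS.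
    by apply/negP => /dimvS; rewrite dq dim_vline q1.
  by case/subvPn=> _ /memv_imgP[w _ ->] ?; exists w.
have q20 : q w2 != 0 by apply: contraNneq q2 => ->; rewrite mem0v.
(* [Pi] is the intersection of the invariant 6-spaces that it spans with [w1] and with [w2], so it
   is itself invariant. *)
have qg0 x : q x = 0 -> q (g x) = 0.
  move=> qx0; have xPi : x \in vs Pi by rewrite -qK memv_ker qx0.
  have /vlineP[a Ea] := inv w1 x q1 (subvP (addvSl _ _) _ xPi).
  have /vlineP[b Eb] := inv w2 x q20 (subvP (addvSl _ _) _ xPi).
  have [b0|b0] := eqVneq b 0; first by rewrite Eb b0 scale0r.
  case/negP: q2; apply/vlineP; exists (b^-1 * a).
  by rewrite -scalerA -Ea Eb scalerK.
have [e E] : exists e : K, (q \o g)%VF = e *: q.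
  apply: (@pointwise_multiple _ _ _ _ _ w1 w2) => // w; rewrite comp_lfunE.
  have [qw|qw] := eqVneq (q w) 0; first by rewrite qg0 // mem0v.
  by apply: inv => //; rewrite (subvP (addvSr _ _)) ?memv_line.
have qg w : q (g w) = e *: q w.
  by have /lfunP/(_ w) := E; rewrite comp_lfunE scale_lfunE.
exists e.
  (* Moving [q] past [g] three times turns [g^3 w1 = c w1] into [e^3 (q w1) = c (q w1)]. *)
  have := qg (g (g w1)); rewrite g3 linearZ !qg !scalerA -expr2 -exprSr /=.
  move/eqP; rewrite -subr_eq0 -scalerBl scaler_eq0 (negPf q1) orbF subr_eq0.
  by move/eqP.
apply/subvP=> _ /memv_imgP[w _ ->].
by rewrite -qK memv_ker hwise_factorE linearB linearZ /= qg subrr.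
Qed.

(* If [g^2 v = a g v + b v] then [c v = g^3 v] forces [b = - a^2] and
   [c = - a^3], so that [e = - a]. *)
Lemma mem_lker_cofactor (K : fieldType) (V : vectType K) (g : 'End(V)) (c : K)
    (v : V) :
  (forall v, g (g (g v)) = c *: v) -> v != 0 -> g v \notin <[v]>%VS ->
  (g (g v) \in <[v]> + <[g v]>)%VS ->
  exists2 e, e ^+ 3 = c & v \in lker (hwise_cofactor g e).
Proof.
move=> g3 v0 gv /memv_addP[_ /vlineP[b ->] [_ /vlineP[a ->] E]].
have indep x y : x *: v + y *: g v = 0 -> x = 0 /\ y = 0.
  have [->|y0] := eqVneq y 0.
    by rewrite scale0r addr0 => /eqP; rewrite scaler_eq0 (negPf v0) orbF => /eqP.
  move=> /eqP; rewrite addr_eq0 => /eqP Exy; case/negP: gv.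
  apply/vlineP; exists (- (y^-1 * x)).
  by rewrite scaleNr -scalerA Exy scalerN opprK scalerK.
have [] := indep (a * b - c) (b + a ^+ 2).
  have := g3 v; rewrite E linearD !linearZ /= E scalerDr !scalerA -expr2.
  rewrite scalerBl scalerDl => <-.
  set x := _ *: v; set y := b *: _; set z := _ *: g v.
  by rewrite [y + (x + z)]addrCA opprD addNKr addNr.
move=> Ec Eb; have {}Eb : b = - a ^+ 2 by apply/eqP; rewrite -addr_eq0 Eb.
exists (- a); first by move/subr0_eq: Ec => <-; rewrite Eb; ring.
rewrite memv_ker hwise_cofactorE E Eb scaleNr scaleNr sqrrN.
by rewrite addrK addNr.
Qed.

(** Subtracting the two quadratic relations cancels [g^2 v] and leaves a relation between the
    independent vectors [g v] and [v], in which [g v] has coefficient [e - e']. *)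
Lemma cofactor_unique (K : fieldType) (V : vectType K) (g : 'End(V)) (e e' : K)
    (v : V) :
  g v \notin <[v]>%VS -> v \in lker (hwise_cofactor g e) ->
  v \in lker (hwise_cofactor g e') -> e = e'.
Proof.
move=> gv; rewrite !memv_ker !hwise_cofactorE => /eqP E /eqP E'.
have : (e - e') *: g v + (e ^+ 2 - e' ^+ 2) *: v = 0.
  move: (etrans E (esym E')); rewrite -!addrA => /addrI /eqP.
  by rewrite -subr_eq0 opprD addrACA -!scalerBl => /eqP.
have [/subr0_eq //|d0] := eqVneq (e - e') 0.
move=> /eqP; rewrite addrC addr_eq0 => /eqP Ed; case/negP: gv.
apply/vlineP; exists (- ((e - e')^-1 * (e ^+ 2 - e' ^+ 2))).
by rewrite scaleNr -scalerA Ed scalerN opprK scalerK.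
Qed.

(** * Semilinear maps in subplane coordinates *)

Lemma identificationD (F : fieldType) (L : fieldExtType F)
    (beta : 'rV[L]_3 -> 'rV[F]_9) :
  identification beta -> {morph beta : u v / u + v}.
Proof. by move=> [_ betaP] u v; have := betaP 1 u v; rewrite !scale1r. Qed.

Lemma identification0 (F : fieldType) (L : fieldExtType F)
    (beta : 'rV[L]_3 -> 'rV[F]_9) : identification beta -> beta 0 = 0.
Proof.
by move=> hb; apply: (@addrI _ (beta 0)); rewrite -identificationD // !addr0.
Qed.

(** The unit vectors have coordinates in [F], so [T] preserves the [L]-line of each and acts on each
    coordinate by a map of [L]. The sums of two unit vectors also have coordinates in [F], and this
    makes all these maps equal. *)
Lemma coordinatewise (F : fieldType) (L : fieldExtType F) (n : nat)
    (T : 'rV[L]_n.+1 -> 'rV[L]_n.+1) :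
  (forall (a : F) u v, T (a%:A *: u + v) = a%:A *: T u + T v) ->
  (forall l (a : 'rV[F]_n.+1), exists m,
    T (l *: map_mx (in_alg L) a) = m *: map_mx (in_alg L) a) ->
  exists h : 'End(L), forall v, T v = map_mx h v.
Proof.
move=> TP Tsub.
have TD u v : T (u + v) = T u + T v.
  by have := TP 1 u v; rewrite !scale1r.
have T0 : T 0 = 0.
  by apply: (@addrI _ (T 0)); rewrite -TD !addr0.
pose d i : 'rV[L]_n.+1 := delta_mx 0 i.
have dE i : d i = map_mx (in_alg L) (delta_mx 0 i) by rewrite map_delta_mx.
pose h l := T (l *: d 0) 0 0.
have hlin : linear h.
  by move=> a u v; rewrite /h scalerDl -mulr_algl -scalerA TP !mxE mulr_algl.
pose hL : {linear L -> L} := HB.pack h (GRing.isLinear.Build F L L *:%R h hlin).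
have Td i l : T (l *: d i) = h l *: d i.
  have [m Em] := Tsub l (delta_mx 0 i); rewrite -dE in Em.
  have [m0 Em0] := Tsub l (delta_mx 0 0); rewrite -dE in Em0.
  have hm0 : h l = m0 by rewrite /h Em0 !mxE !eqxx mulr1.
  have [->|i0] := eqVneq i 0; first by rewrite Em0 hm0.
  (* The image of [l (d i + d 0)] is a multiple of [d i + d 0], so its coordinates at [i] and at [0]
     agree. *)
  have [k] := Tsub l (delta_mx 0 i + delta_mx 0 0).
  rewrite map_mxD -!dE scalerDr TD Em Em0 => E.
  suff -> : m = m0 by rewrite hm0.
  have := congr1 (fun u : 'rV_n.+1 => u 0 i) E.
  have := congr1 (fun u : 'rV_n.+1 => u 0 0) E.
  rewrite !mxE !eqxx /= eq_sym (negPf i0) !(mulr0, mulr1, addr0, add0r).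
  by move=> -> ->.
exists (linfun hL) => v.
rewrite {1}[v]row_sum_delta (big_morph T TD T0).
rewrite [RHS]row_sum_delta; apply: eq_bigr => i _.
by rewrite -/(d i) Td mxE lfunE.
Qed.

(* With [m x = h x / h 1], the hypothesis on [h] says that [h] is semilinear
   with respect to the field automorphism [m]; [m] has order 3, hence its
   fixed field is [F], and [1], [m], [m^2] are linearly independent. *)
Lemma semilinear_eigen (F : fieldType) (L : fieldExtType F) (h : 'End(L)) (c e : F) :
  \dim {:L} = 3%N -> lker h = 0%VS ->
  (forall l x : L, h (l * x) * h 1 = h x * h l) -> ~ (forall x, h x = h 1 * x) ->
  (forall x, h (h (h x)) = c *: x) -> e ^+ 3 = c ->
  exists x0, let l0 := hwise_cofactor h e x0 in
    [/\ l0 != 0, h l0 = e *: l0 &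
        forall y, h y = e *: y -> exists a : F, y = l0 * a%:A].
Proof.
move=> dL kh hM hN h3 ec.
have h_eq0 x : (h x == 0) = (x == 0) by rewrite -memv_ker kh memv0.
have h1 : h 1 != 0 by rewrite h_eq0 oner_eq0.
pose m : 'End(L) := (amulr (h 1)^-1%R \o h)%VF.
have mE x : m x = h x / h 1 by rewrite comp_lfunE lfunE.
have hm l x : h (l * x) = m x * h l.
  by apply: (mulIf h1); rewrite hM mE mulrAC divfK.
have m1 : m 1 = 1 by rewrite mE divff.
have mM x y : m (x * y) = m x * m y by rewrite mE hm -mulrA mulrC -mE.
have mA : ahom_in {:L} m by apply/ahom_inP; split=> [x y _ _|].
pose mH := AHom mA.
have hhm l x : h (h (l * x)) = m (m x) * h (h l) by rewrite hm mulrC hm.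
have c0 : c != 0.
  apply: contraTneq (oner_neq0 L) => c0; rewrite negbK -h_eq0 -h_eq0 -h_eq0.
  by rewrite h3 c0 scale0r.
(* Written at [1 * x], the relation [h^3 = c] reads [m^3(x) h^3(1) = c x], and [h^3(1) = c]. *)
have m3 x : m (m (m x)) = x.
  have := h3 x; rewrite -{1}[x]mul1r hhm mulrC hm h3 => E.
  by apply: (scalerI c0); rewrite -{}E -scalerAr mulr1.
have [x mx] : exists x, m x != x.
  have /lfunPn[x] : m != \1%VF.
    apply/eqP=> mid; apply: hN => x.
    by rewrite -{1}[x]mul1r hm mid id_lfunE mulrC.
  by rewrite id_lfunE; exists x.
(* The degree of the fixed field divides 3, and it is not 3 because [m] moves [x]. *)
have fixm y : m y = y -> exists a : F, y = a%:A.
  move=> my; have yK : y \in fixedSpace mH by apply/fixedSpaceP.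
  have := field_dimS (subvf (fixedSpace_aspace mH)); rewrite dL /=.
  rewrite dvdn_divisors // !inE => /orP[] /eqP dK.
    have /eqP E : (1%VS == fixedSpace mH :> {vspace L}).
      by rewrite eqEdim dimv1 dK andbT -memvE; apply/fixedSpaceP.
    by move: yK; rewrite -E => /vlineP.
  have /eqP E : fixedSpace mH == fullv by rewrite eqEdim subvf dK dL.
  case/eqP: mx; apply/fixedSpaceP; change (x \in fixedSpace mH).
  by rewrite E memvf.
have [x0] : exists x0, hwise_cofactor h e x0 != 0.
  have [Q0|/lfunPn[x0]] := eqVneq (hwise_cofactor h e) 0; last first.
    by rewrite zero_lfunE; exists x0.
  have Q y : h (h y) + e *: h y + e ^+ 2 *: y = 0.
    by rewrite -hwise_cofactorE Q0 zero_lfunE.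
  (* Dedekind's argument: subtracting [z] times the relation at [y] from the relation at [y z]
     removes one term. A second elimination, between [y = 1] and [y = x] with [z = x], leaves a
     product that cannot vanish when [m] has order 3. *)
  have E1 y z : (m (m z) - z) * h (h y) + (m z - z) * (e *: h y) = 0.
    have := Q (y * z); rewrite hhm hm.
    have /eqP := Q y; rewrite addrC addr_eq0 => /eqP E.
    rewrite [e *: (_ * _)]scalerAr [_ *: (y * z)]scalerAl E => <-.
    by ring.
  have E2 := E1 1 x; have := E1 (1 * x) x; rewrite hhm hm scalerAr => E3.
  have : (m (m x) - x) * (m (m x) - m x) * h (h 1) = 0.
    suff elim (a b A B s t : L) : a * (s * A) + b * (t * B) = 0 ->
        a * A + b * B = 0 -> a * (s - t) * A = 0 by exact: elim E3 E2.
    move=> p q.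
    have -> : a * (s - t) * A = a * (s * A) + b * (t * B) - t * (a * A + b * B).
      by ring.
    by rewrite p q mulr0 subr0.
  move/eqP; rewrite !mulf_eq0 !h_eq0 oner_eq0 orbF !subr_eq0 => /orP[] /eqP Ex.
    by rewrite -{1}Ex m3 eqxx in mx.
  by case/eqP: mx; rewrite -[RHS]m3 !Ex.
move=> l0; exists x0 => /=; set l := hwise_cofactor h e x0 in l0 *.
have hl : h l = e *: l.
  rewrite /l hwise_cofactorE !linearD !linearZ /= h3 -ec !scalerA.
  by rewrite -exprSr -expr2 [RHS]addrC addrA.
split=> // y hy.
(* Since [y] and [l] are eigenvectors of [h] for the same [e], semilinearity applied to
   [y = (y / l) l] shows that [m] fixes the quotient. *)
have [|a Ea] := fixm (y / l).
  apply: (mulIf l0); rewrite divfK //.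
  have e0 : e != 0 by apply: contraNneq c0 => e0; rewrite -ec e0 expr0n.
  apply: (scalerI e0); rewrite -hy scalerAr -hl -hm.
  by rewrite mulrC divfK.
by exists a; rewrite -Ea mulrC divfK.
Qed.

(** A vector lies in the kernel of [g - e] iff each of its coordinates is an [e]-eigenvector of [h],
    that is, an [F]-multiple of one [l]. So this kernel is a copy of [F^3], and the image of [g - e]
    has dimension 6. The image of the cofactor contains that copy, so its kernel has dimension at
    most 6, and the inclusion of [limg_factor_sub] is an equality. *)
Lemma factor_exact (F : fieldType) (L : fieldExtType F) (beta : 'rV[L]_3 -> 'rV[F]_9)
    (M : 'M[L]_3) (g : 'End('rV[F]_9)) (h : 'End(L)) (c e : F) :
  identification beta -> M \in unitmx -> \dim {:L} = 3%N -> lker h = 0%VS ->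
  (forall l x : L, h (l * x) * h 1 = h x * h l) -> ~ (forall x, h x = h 1 * x) ->
  (forall v, g (beta (v *m M)) = beta (map_mx h v *m M)) ->
  (forall v, g (g (g v)) = c *: v) -> e ^+ 3 = c ->
  limg (hwise_factor g e) = lker (hwise_cofactor g e) /\
  \dim (limg (hwise_factor g e)) = 6%N.
Proof.
move=> hbeta uM dL kh hM hN gh g3 ec; have [bij_beta betaP] := hbeta.
have beta_inj := bij_inj bij_beta.
have betaD := identificationD hbeta; have beta0 := identification0 hbeta.
have betaZ a u : beta (a%:A *: u) = a *: beta u.
  by have := betaP a u 0; rewrite !addr0 beta0 addr0.
have bM_inj u v : beta (u *m M) = beta (v *m M) -> u = v.
  by move=> /beta_inj E; rewrite -(mulmxK uM u) E mulmxK.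
have bMZ a u : beta ((a%:A *: u) *m M) = a *: beta (u *m M).
  by rewrite -scalemxAl betaZ.
have bMD u v : beta ((u + v) *m M) = beta (u *m M) + beta (v *m M).
  by rewrite mulmxDl betaD.
have h3 x : h (h (h x)) = c *: x.
  have : beta (map_mx h (map_mx h (map_mx h (const_mx x))) *m M)
       = beta ((c%:A *: const_mx x) *m M) by rewrite bMZ -!gh g3.
  by move/bM_inj/rowP/(_ 0); rewrite !mxE mulr_algl.
have [x0 /=] := semilinear_eigen dL kh hM hN h3 ec.
set l := hwise_cofactor h e x0 => -[l0 hl hfix].
pose j (a : 'rV[F]_3) := beta ((l *: map_mx (in_alg L) a) *m M).
have jlin : linear j.
  move=> k u v; rewrite /j map_mxD map_mxZ scalerDr bMD -bMZ.
  by rewrite !scalerA mulrC.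
pose jL : {linear 'rV[F]_3 -> 'rV[F]_9} :=
  HB.pack j (GRing.isLinear.Build F 'rV[F]_3 'rV[F]_9 *:%R j jlin).
have jE a : linfun jL a = j a by rewrite lfunE.
have kj : lker (linfun jL) = 0%VS.
  apply/eqP/lker0P => a b; rewrite !jE => /bM_inj/rowP E.
  apply/rowP=> i; have := E i; rewrite !mxE => /(mulfI l0).
  exact: (fmorph_inj (in_alg L)).
have dj : \dim (limg (linfun jL)) = 3%N.
  by rewrite limg_dim_eq ?kj ?capv0 // dimvf /dim /= mul1n.
(* As [l] is the value of the cofactor of [h] at [x0], the vector [l a] is the coordinatewise
   cofactor image of [x0 a], for [a] over [F]. *)
have jQ : (limg (linfun jL) <= limg (hwise_cofactor g e))%VS.
  apply/subvP=> _ /memv_imgP[a _ ->]; rewrite jE.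
  apply/memv_imgP; exists (beta ((x0 *: map_mx (in_alg L) a) *m M)); rewrite ?memvf //.
  rewrite hwise_cofactorE !gh -!bMZ -!bMD /j; congr (beta (_ *m M)).
  apply/rowP=> i; rewrite !mxE /l hwise_cofactorE !mulr_algl !mulr_algr !linearZ /=.
  by rewrite !scalerDr.
have kN : lker (hwise_factor g e) = limg (linfun jL).
  apply/eqP; rewrite eqEsubv; apply/andP; split; apply/subvP=> u; last first.
    case/memv_imgP=> a _ ->; rewrite jE memv_ker hwise_factorE subr_eq0 /j gh -bMZ.
    apply/eqP; congr (beta (_ *m M)); apply/rowP=> i.
    by rewrite !mxE mulr_algl mulr_algr linearZ /= hl scalerA mulrC -scalerA.
  rewrite memv_ker hwise_factorE subr_eq0 => /eqP gu.
  have [gamma betaK gammaK] := bij_beta.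
  have [v uv] : exists v, u = beta (v *m M).
    by exists (gamma u *m invmx M); rewrite mulmxKV // gammaK.
  move: gu; rewrite uv gh -bMZ => /bM_inj/rowP hv.
  have vP i : exists a : F, v 0 i == l * a%:A.
    by have := hv i; rewrite !mxE mulr_algl => /hfix[a /eqP]; exists a.
  apply/memv_imgP; exists (\row_i xchoose (vP i)); rewrite ?memvf // jE /j.
  congr (beta (_ *m M)); apply/rowP=> i; rewrite !mxE.
  by have /eqP := xchooseP (vP i).
have dN : \dim (limg (hwise_factor g e)) = 6%N.
  have := limg_ker_dim (hwise_factor g e) fullv.
  rewrite capfv kN dj dimvf /dim /= mul1n.
  by move/(congr1 (subn^~ 3)); rewrite addKn.
split=> //; apply/eqP; rewrite eqEdim (limg_factor_sub g3 ec) dN.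
have := limg_ker_dim (hwise_cofactor g e) fullv.
rewrite capfv dimvf /dim /= mul1n => dQ.
rewrite -(leq_add2r (\dim (limg (hwise_cofactor g e)))) dQ.
by rewrite (leq_add2l 6 3); have := dimvS jQ; rewrite dj.
Qed.

(** * The hwise-fixed 5-space through a point or a fixed line *)

Lemma point_span (K : fieldType) (n : nat) (P : PGpoint K n) (v : 'rV[K]_n.+1) :
  v \in vs P -> v != 0 -> vs P = <[v]>%VS.
Proof.
move=> vP v0; apply/esym/eqP.
by rewrite eqEdim -memvE vP dim_vs dim_vline v0.
Qed.

Lemma line_span (K : fieldType) (n : nat) (l : PGline K n) (v w : 'rV[K]_n.+1) :
  v \in vs l -> w \in vs l -> v != 0 -> w \notin <[v]>%VS ->
  vs l = (<[v]> + <[w]>)%VS.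
Proof.
move=> vl wl v0 wv; apply/esym/eqP; rewrite eqEdim subv_add -!memvE vl wl dim_vs.
have w0 : w != 0 by apply: contraNneq wv => ->; rewrite mem0v.
rewrite dimv_disjoint_sum ?dim_vline ?v0 ?w0 //.
apply/eqP; rewrite -subv0; apply/subvP=> x; rewrite memv_cap memv0.
case/andP=> xv /vlineP[k xk]; move: xv; rewrite xk.
have [->|k0] := eqVneq k 0; first by rewrite scale0r.
by move/(memvZ k^-1); rewrite scalerK // (negPf wv).
Qed.

(** By [key], the hwise-fixed 5-spaces are the kernels of the cofactors, so those through [A]
    correspond to the [e] whose cofactor kills a vector of [A], and there is exactly one. For lines,
    a [g]-invariant subspace containing [A] contains the fixed line through [A]. *)
Lemma exists_unique_hwise_fixed (K : fieldType) (sigma : PGpoint K 8 -> PGpoint K 8)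
    (g : 'End('rV[K]_9)) (c : K) :
  lker g = 0%VS -> (forall A, vs (sigma A) = (g @: vs A)%VS) ->
  (forall v, g (g (g v)) = c *: v) ->
  (forall e, e ^+ 3 = c -> limg (hwise_factor g e) = lker (hwise_cofactor g e) /\
     \dim (limg (hwise_factor g e)) = 6%N) ->
  forall A : PGpoint K 8, A <> sigma A -> collinear A (sigma A) (sigma (sigma A)) ->
  (exists! Pi : PG K 8 5, hwise_fixed_5space sigma Pi /\ incident A Pi) /\
  (forall l : PGline K 8, fixes sigma l -> incident A l ->
     exists! Pi : PG K 8 5, hwise_fixed_5space sigma Pi /\ incident l Pi).
Proof.
move=> g0 sg g3 key A nA [l0 [A0 A1 A2]].
have [v v0 Av] := vector_of_point A.
have gv : g v \notin <[v]>%VS.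
  apply/negP; rewrite memvE => sgv; apply: nA; apply: vs_inj; apply/esym/eqP.
  by rewrite eqEdim !dim_vs andbT sg Av limg_line.
have hwiseE Pi : hwise_fixed_5space sigma Pi ->
    exists2 e, e ^+ 3 = c & vs Pi = limg (hwise_factor g e).
  move=> hPi; have [e ec le] := factor_of_hwise_fixed g0 sg g3 hPi.
  exists e => //; apply/esym/eqP; rewrite eqEdim le dim_vs.
  by have [_ ->] := key e ec.
(* [g] commutes with [g - e], so it preserves the image of the latter. *)
have hwise_inv Pi x : hwise_fixed_5space sigma Pi -> x \in vs Pi -> g x \in vs Pi.
  case/hwiseE=> e _ -> /memv_imgP[y _ ->]; apply/memv_imgP; exists (g y).
    exact: memvf.
  by rewrite !hwise_factorE linearB linearZ.
have [e ec ve] : exists2 e, e ^+ 3 = c & v \in lker (hwise_cofactor g e).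
  apply: (mem_lker_cofactor g3 v0 gv).
  rewrite -(@line_span _ _ l0) //; first by rewrite memvE -!limg_line -Av -!sg.
    by rewrite memvE -Av.
  by rewrite memvE -limg_line -Av -sg.
have [Ee de] := key e ec.
have [Pi PiE] := PG_exists de.
have hPi : hwise_fixed_5space sigma Pi by apply: (hwise_fixed_factor g0 sg PiE).
have APi : incident A Pi by rewrite /incident PiE Ee Av -memvE.
have uPi Pi' : hwise_fixed_5space sigma Pi' -> incident A Pi' -> Pi = Pi'.
  move=> /hwiseE[e' ec' PiE'] AP'; apply: vs_inj; rewrite PiE PiE'.
  congr (limg (hwise_factor g _)); apply: cofactor_unique gv ve _.
  by have [<- _] := key e' ec'; rewrite -PiE' memvE -Av.
split; first by exists Pi; split=> // Pi' []; apply: uPi.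
move=> l /(sub_fixesP _ g0 sg) gl Al.
have lE : vs l = (<[v]> + <[g v]>)%VS.
  have vl : v \in vs l by rewrite memvE -Av.
  by apply: line_span => //; apply: (subvP gl); rewrite memv_img.
exists Pi; split=> [|Pi' [hP' lP']].
  split=> //; rewrite /incident lE subv_add -!memvE.
  have vPi : v \in vs Pi by rewrite memvE -Av.
  by rewrite vPi hwise_inv.
by apply: uPi => //; apply: subv_trans lP'.
Qed.

(** * The semilinear map underlying [sigma] *)

(** Transported to [L^3] in the basis [M], [g] becomes an [F]-linear map [T] that preserves the
    [L]-line of every subplane point, because [phi] fixes these points; [coordinatewise] then gives
    [h]. *)
Lemma sigma_coordinates (F : fieldType) (L : fieldExtType F) (M : 'M[L]_3)
    (phi : PGpoint L 2 -> PGpoint L 2)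
    (beta : 'rV[L]_3 -> 'rV[F]_9) (g : 'End('rV[F]_9)) :
  M \in unitmx ->
  (forall a : 'rV[F]_3, a != 0 -> exists2 P, phi P = P &
     vs P = <[map_mx (in_alg L) a *m M]>%VS) ->
  ~ phi =1 id -> identification beta -> lker g = 0%VS ->
  (forall P, (g @: bose beta P)%VS = bose beta (phi P)) ->
  exists h : 'End(L),
    [/\ lker h = 0%VS, forall l x : L, h (l * x) * h 1 = h x * h l,
        ~ (forall x, h x = h 1 * x) &
        forall v, g (beta (v *m M)) = beta (map_mx h v *m M)].
Proof.
move=> uM subP phi1 hbeta kg gb.
have [bij_beta betaP] := hbeta; have [gamma betaK gammaK] := bij_beta.
have beta_inj := bij_inj bij_beta.
have beta0 := identification0 hbeta.
have M_eq0 (v : 'rV[L]_3) : v *m M = 0 -> v = 0.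
  by move=> E; rewrite -(mulmxK uM v) E mul0mx.
have gbP P u : u \in vs P -> gamma (g (beta u)) \in vs (phi P).
  by move=> uP; rewrite -(mem_bose hbeta) gammaK -gb memv_img // mem_bose.
pose T v := gamma (g (beta (v *m M))) *m invmx M.
have TE v : T v *m M = gamma (g (beta (v *m M))) by rewrite mulmxKV.
have TP (a : F) u v : T (a%:A *: u + v) = a%:A *: T u + T v.
  rewrite /T mulmxDl -scalemxAl betaP linearD linearZ /= scalemxAl -mulmxDl.
  by congr (_ *m _); apply: beta_inj; rewrite betaP !gammaK.
have T0 : T 0 = 0 by rewrite /T mul0mx beta0 linear0 -beta0 betaK mul0mx.
have [h Th] : exists h : 'End(L), forall v, T v = map_mx h v.
  apply: coordinatewise => // l a.
  have [->|/subP[P fP PE]] := eqVneq a 0.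
    by exists 0; rewrite map_mx0 !scaler0.
  have := gbP P ((l *: map_mx (in_alg L) a) *m M).
  rewrite -TE fP PE -scalemxAl memvZ ?memv_line // => /(_ isT)/vlineP[k E].
  by exists k; rewrite -[LHS](mulmxK uM) E scalemxAl mulmxK.
have gh v : g (beta (v *m M)) = beta (map_mx h v *m M).
  by rewrite -Th TE gammaK.
exists h; split=> //.
- apply/eqP; rewrite -subv0; apply/subvP=> x; rewrite memv_ker memv0 => /eqP hx.
  have : beta (const_mx x *m M) \in lker g.
    rewrite memv_ker gh (_ : map_mx h (const_mx x) = 0) ?mul0mx ?beta0 //.
    by apply/rowP=> i; rewrite !mxE.
  rewrite kg memv0 -beta0 => /eqP/beta_inj/M_eq0/rowP/(_ 0).
  by rewrite !mxE => ->.
- move=> l x.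
  (* Take the point [(1, x, 0)]. The images of [v] and [l v] both lie on the [L]-line of [phi P], so
     the determinant of [(h 1, h x)] and [(h l, h (l x))] vanishes. *)
  pose v : 'rV[L]_3 := delta_mx 0 0 + x *: delta_mx 0 1.
  have v0 : v *m M != 0.
    apply/eqP => /M_eq0/rowP/(_ 0)/eqP.
    by rewrite !mxE /= mulr0 addr0 oner_eq0.
  have [P PE] := point_of_vector v0; have [w w0 phiPE] := vector_of_point (phi P).
  have coord k : exists a, forall i, h (k * v 0 i) = a * (w *m invmx M) 0 i.
    have : gamma (g (beta ((k *: v) *m M))) \in vs (phi P).
      by apply: gbP; rewrite PE -scalemxAl memvZ // memv_line.
    rewrite gh betaK phiPE => /vlineP[a E]; exists a => i.
    have /rowP/(_ i) := congr1 (mulmx^~ (invmx M)) E.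
    by rewrite mulmxK // -scalemxAl !mxE.
  have [a Ea] := coord 1; have [b Eb] := coord l.
  move: (Ea 0) (Ea 1) (Eb 0) (Eb 1); rewrite !mxE /=.
  rewrite !(mulr0, mulr1, addr0, add0r, mul1r) => -> -> -> ->.
  by ring.
(* If [h] is multiplication by [h 1], then so is [T], and [phi] fixes every point. *)
- move=> hlin; apply: phi1 => P.
  have [u u0 uP] := vector_of_point P.
  have [v uE] : exists v, u = v *m M by exists (u *m invmx M); rewrite mulmxKV.
  have h1 : h 1 != 0.
    apply: contraNneq u0 => h1.
    have : beta u \in lker g.
      rewrite memv_ker uE gh (_ : map_mx h v = 0) ?mul0mx ?beta0 //.
      by apply/rowP=> i; rewrite !mxE hlin h1 mul0r.
    by rewrite kg memv0 -{1}beta0 => /eqP/beta_inj ->.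
  have := gbP P u; rewrite {1}uP memv_line => /(_ isT).
  rewrite {1}uE gh betaK (_ : map_mx h v = h 1 *: v); last first.
    by apply/rowP=> i; rewrite !mxE hlin.
  rewrite -scalemxAl -uE => /(memvZ (h 1)^-1); rewrite scalerK // => uphi.
  apply/esym/vs_inj/eqP; rewrite eqEdim !dim_vs leqnn andbT uP.
  by rewrite -memvE.
Qed.

Theorem theorem10 (F : finFieldType) (L : fieldExtType F)
  (hq : (2 < #|F|)%N) (hL : \dim {:L} = 3%N)
  (S : PGpoint L 2 -> Prop) (hS : Fsubplane S)
  (phi : PGpoint L 2 -> PGpoint L 2)
  (hphi : collineation phi) (hphi3 : has_order phi 3)
  (hphiS : forall P, S P -> phi P = P)
  (beta : 'rV[L]_3 -> 'rV[F]_9) (hbeta : identification beta)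
  (sigma : PGpoint F 8 -> PGpoint F 8)
  (hsigma : projectivity sigma) (hsigma3 : has_order sigma 3)
  (hsigmaphi : forall P, maps_onto sigma (bose beta P) (bose beta (phi P))) :
  (forall A : PGpoint F 8,
     Idots_point beta S sigma A \/ IIdots_point beta phi sigma A ->
     exists! Pi : PG F 8 5, hwise_fixed_5space sigma Pi /\ incident A Pi) /\
  (forall l : PGline F 8,
     fixed_I_line beta S sigma l \/ fixed_II_line beta phi sigma l ->
     exists! Pi : PG F 8 5, hwise_fixed_5space sigma Pi /\ incident l Pi).
Proof.
have [g kg sg] := hsigma; have [M uM SP] := hS.
have [c g3] := cube_scalar sg hsigma3.
have gb P : (g @: bose beta P)%VS = bose beta (phi P).
  exact/(maps_ontoP _ _ sg).
have [||h [kh hM hN gh]] := sigma_coordinates uM _ _ hbeta kg gb.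
- move=> a a0; have [|P PE] := @point_of_vector _ _ (map_mx (in_alg L) a *m M).
    apply: contraNneq a0 => E; rewrite -(map_mx_eq0 (in_alg L)).
    by rewrite -(mulmxK uM (map_mx _ a)) E mul0mx.
  by exists P => //; apply/hphiS/SP; exists a.
- by have [_ _ /(_ 1 isT)] := hphi3.
have key e (ec : e ^+ 3 = c) := factor_exact hbeta uM hL kh hM hN gh g3 ec.
have main := exists_unique_hwise_fixed kg sg g3 key.
(* If [A] were fixed, it would lie in the planes of both [P] and [phi P]. A nonzero vector of [A]
   then gives a vector of [L^3] spanning both points, against type II. *)
have IIneq A : IIdots_point beta phi sigma A -> A <> sigma A.
  move=> [[P [[nP _ _] _] AP] _] EA.
  have [v v0 Av] := vector_of_point A.
  have [[gamma betaK gammaK] _] := hbeta.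
  have vP : gamma v \in vs P by rewrite -(mem_bose hbeta) gammaK memvE -Av.
  have vP' : gamma v \in vs (phi P).
    rewrite -(mem_bose hbeta) gammaK memvE -Av EA sg -gb; exact: limgS.
  have u0 : gamma v != 0.
    apply: contraNneq v0 => E; rewrite -[v]gammaK E.
    by rewrite (identification0 hbeta).
  by apply: nP; apply: vs_inj; rewrite (point_span vP u0) (point_span vP' u0).
have dots A : Idots_point beta S sigma A \/ IIdots_point beta phi sigma A ->
    A <> sigma A /\ collinear A (sigma A) (sigma (sigma A)).
  by case=> [[_ [? _ _] ?]|AII] //; split; [apply: IIneq | case: AII].
split=> [A /dots[nA cA]|l]; first by have [] := main A nA cA.
case=> -[fl [A Adots Al]].
  have [nA cA] := dots A (or_introl Adots).
  by have [_ hl] := main A nA cA; apply: hl.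
have [nA cA] := dots A (or_intror Adots).
by have [_ hl] := main A nA cA; apply: hl.
Qed.
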